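(* Let $n\ge2$, $d\ge1$, $\alpha\in(0,1)$ and let $\boldsymbol\sigma=(\sigma_1,\dots,\sigma_n)$ be arbitrary positive noise levels (heteroscedastic model, with $\sigma_i^\#=\sigma_{\pi^*(i)}$). If $\hat\pi$ is either $\pi^{\mathrm{LSNS}}$ (computed with the known noise levels) or $\pi^{\mathrm{LSL}}$, then $$\bar\kappa_\alpha(\hat\pi)\le 4\max\Big\{\Big(2\log\frac{8n^2}{\alpha}\Big)^{1/2},\ \Big(d\log\frac{4n^2}{\alpha}\Big)^{1/4}\Big\}.$$
   Context: Model: integers $n\ge2$, $d\ge1$. Unknown parameters: $\boldsymbol\theta=(\theta_1,\dots,\theta_n)$ with $\theta_i\in\mathbb R^d$, noise levels $\boldsymbol\sigma=(\sigma_1,\dots,\sigma_n)$ with $\sigma_i>0$, and a permutation $\pi^*\in\mathfrak S_n$ (the symmetric group on $\{1,\dots,n\}$). One observes $X_i=\theta_i+\sigma_i\xi_i$, $X_i^\#=\theta_{\pi^*(i)}+\sigma_i^\#\xi_i^\#$, $i=1,\dots,n$, where $\sigma_i^\#=\sigma_{\pi^*(i)}$ and $\xi_1,\dots,\xi_n,\xi_1^\#,\dots,\xi_n^\#$ are i.i.d. $\mathcal N(0,I_d)$. The law of the data is $\mathbf P_{\boldsymbol\theta,\boldsymbol\sigma,\pi^*}$. Ties in argmins are broken arbitrarily (measurably). Estimators: $\pi^{\mathrm{LSNS}}=\arg\min_{\pi\in\mathfrak S_n}\sum_{i=1}^n\frac{\|X_{\pi(i)}-X_i^\#\|^2}{\sigma_{\pi(i)}^2+(\sigma_i^\#)^2}$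 and $\pi^{\mathrm{LSL}}=\arg\min_{\pi\in\mathfrak S_n}\sum_{i=1}^n\log\|X_{\pi(i)}-X_i^\#\|^2$. Relative separation distance: $\bar\kappa(\boldsymbol\theta,\boldsymbol\sigma)=\min_{i\ne j}\frac{\|\theta_i-\theta_j\|}{(\sigma_i^2+\sigma_j^2)^{1/2}}$. Perceivable separation distance of an estimator $\hat\pi$: $\bar\kappa_\alpha(\hat\pi)=\inf\{\kappa>0:\ \max_{\pi\in\mathfrak S_n}\sup_{\boldsymbol\theta:\,\bar\kappa(\boldsymbol\theta,\boldsymbol\sigma)>\kappa}\mathbf P_{\boldsymbol\theta,\boldsymbol\sigma,\pi}(\hat\pi\ne\pi)\le\alpha\}$. *)

(* Defs.v *)
From HB Require Import structures.
From mathcomp Require Import all_boot all_order all_algebra all_fingroup.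
From mathcomp Require Import all_classical all_reals all_analysis.
Set Implicit Arguments. Unset Strict Implicit. Unset Printing Implicit Defensive.
Import Order.TTheory GRing.Theory Num.Theory.
Local Open Scope classical_set_scope.
Local Open Scope ring_scope.

Section Defs.
Context {R : realType}.

Definition sqnorm {d : nat} (v : 'rV[R]_d) : R := \sum_(k < d) (v ord0 k) ^+ 2.
Definition enorm {d : nat} (v : 'rV[R]_d) : R := Num.sqrt (sqnorm v).

Definition kbar {n d : nat} (theta : 'I_n -> 'rV[R]_d) (sigma : 'I_n -> R) : \bar R :=
  \big[Order.min/+oo%E]_(i < n) \big[Order.min/+oo%E]_(j < n | i != j)
     (enorm (theta i - theta j) / Num.sqrt (sigma i ^+ 2 + sigma j ^+ 2))%:E.

Definition lsns_cost {n d : nat} (sigma sigmas : 'I_n -> R)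
    (X Xs : 'I_n -> 'rV[R]_d) (pi : 'S_n) : R :=
  \sum_(i < n) sqnorm (X (pi i) - Xs i) / (sigma (pi i) ^+ 2 + sigmas i ^+ 2).

Definition elog (x : R) : \bar R := if x == 0 then -oo%E else (ln x)%:E.
Definition lsl_cost {n d : nat} (X Xs : 'I_n -> 'rV[R]_d) (pi : 'S_n) : \bar R :=
  (\sum_(i < n) elog (sqnorm (X (pi i) - Xs i)))%E.

(* An estimator: a (tie-breaking) function of the noise levels sigma, sigma#
   and the data X, X#. *)
Definition estimator (n d : nat) :=
  ('I_n -> R) -> ('I_n -> R) -> ('I_n -> 'rV[R]_d) -> ('I_n -> 'rV[R]_d) -> 'S_n.

Definition is_LSNS {n d : nat} (est : estimator n d) : Prop :=
  forall sigma sigmas X Xs (pi : 'S_n),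
    lsns_cost sigma sigmas X Xs (est sigma sigmas X Xs) <= lsns_cost sigma sigmas X Xs pi.

Definition is_LSL {n d : nat} (est : estimator n d) : Prop :=
  forall sigma sigmas X Xs (pi : 'S_n),
    (lsl_cost X Xs (est sigma sigmas X Xs) <= lsl_cost X Xs pi)%E.

Section Model.
Context {dT : measure_display} {T : measurableType dT} (P : probability T R).
Context {n d : nat}.

Definition noise_idx := (('I_n * 'I_d) + ('I_n * 'I_d))%type.

Definition noise_var (xi xis : 'I_n -> 'I_d -> T -> R) (k : noise_idx) : T -> R :=
  match k with inl (i, l) => xi i l | inr (i, l) => xis i l end.

(* xi_1..xi_n, xi#_1..xi#_n are i.i.d. N(0, I_d): all n*d*2 coordinates are
   mutually independent standard normal real random variables *)
Definition iid_std_gaussian (xi xis : 'I_n -> 'I_d -> T -> R) : Prop :=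
  (forall k, measurable_fun setT (noise_var xi xis k)) /\
  (forall k (B : set R), measurable B ->
      P (noise_var xi xis k @^-1` B) = normal_prob 0 1 B) /\
  (forall B : noise_idx -> set R, (forall k, measurable (B k)) ->
      P (\bigcap_(k in [set: noise_idx]) (noise_var xi xis k @^-1` B k)) =
      (\prod_(k : noise_idx) P (noise_var xi xis k @^-1` B k))%E).

Definition obsX (xi : 'I_n -> 'I_d -> T -> R) (theta : 'I_n -> 'rV[R]_d)
    (sigma : 'I_n -> R) (w : T) : 'I_n -> 'rV[R]_d :=
  fun i => theta i + sigma i *: \row_(l < d) xi i l w.
Definition obsXs (xis : 'I_n -> 'I_d -> T -> R) (theta : 'I_n -> 'rV[R]_d)
    (sigma : 'I_n -> R) (pis : 'S_n) (w : T) : 'I_n -> 'rV[R]_d :=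
  fun i => theta (pis i) + sigma (pis i) *: \row_(l < d) xis i l w.

Definition err_event (xi xis : 'I_n -> 'I_d -> T -> R) (est : estimator n d)
    (theta : 'I_n -> 'rV[R]_d) (sigma : 'I_n -> R) (pis : 'S_n) : set T :=
  [set w | est sigma (fun i => sigma (pis i)) (obsX xi theta sigma w)
               (obsXs xis theta sigma pis w) != pis].

Definition perceivable (xi xis : 'I_n -> 'I_d -> T -> R) (est : estimator n d)
    (sigma : 'I_n -> R) (alpha : R) : \bar R :=
  ereal_inf [set kappa%:E | kappa in
    [set kappa : R | 0 < kappa /\
       (forall (pis : 'S_n) (theta : 'I_n -> 'rV[R]_d),
          (kappa%:E < kbar theta sigma)%E ->
          (P (err_event xi xis est theta sigma pis) <= alpha%:E)%E)]].

End Model.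
End Defs.

Definition bound3 {R : realType} (n d : nat) (alpha : R) : R :=
  4 * Num.max (Num.sqrt (2 * ln (8 * (n%:R) ^+ 2 / alpha)))
              (powR (d%:R * ln (4 * (n%:R) ^+ 2 / alpha)) (4 ^-1)).

(* Main.v *)
(* An error of either estimator produces indices i and j <> pis i such that
   |v + z1|^2 <= |z2|^2, where z1 and z2 are (dependent) standard Gaussian
   vectors and v = (theta_j - theta_(pis i)) / (sigma_j^2 + sigma_(pis i)^2)^(1/2).
   For the logarithmic criterion the unequal variances cancel by AM-GM, because
   the product of the sigma_(pi i) does not depend on the permutation pi.  A
   Chernoff bound with parameter m <= 1/2, where the dependence between z1 and
   z2 is handled by splitting exp((m/2)(|z2|^2 - |v + z1|^2)) into its two
   factors, bounds the probability of this event by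
   2 exp(m^2 d - m |v|^2 / 6), and m = min(1/2, (log(4n^2/alpha) / d)^(1/2))
   makes it small enough for the union over (i, j).  The coincidences
   X_(pis i) = X#_i, where the logarithm is -oo, have probability at most
   (1 + 2t)^(-1/2) for every t > 0. *)
Require Import Defs.
From HB Require Import structures.
From mathcomp Require Import all_boot all_order all_algebra all_fingroup.
From mathcomp Require Import all_classical all_reals all_analysis.
From mathcomp Require Import measurable_realfun ring lra.
Set Implicit Arguments. Unset Strict Implicit. Unset Printing Implicit Defensive.
Import Order.TTheory GRing.Theory Num.Theory.
Local Open Scope classical_set_scope.
Local Open Scope ring_scope.

(** * Integrals of exponentials of quadratics against a normal law *)

Section GaussianIntegral.
Context {R : realType}.
Local Notation mu := (@lebesgue_measure R).

(** The Radon-Nikodym derivative of [normal_prob m s] equals [normal_pdf m s] almost everywhere,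
    because both have the same integral over every measurable set. *)
Lemma ge0_integral_normal_prob (m s : R) (f : measurableTypeR R -> \bar R) :
  measurable_fun setT f -> (forall x, (0 <= f x)%E) ->
  (\int[normal_prob m s]_x f x = \int[mu]_x (f x * (normal_pdf m s x)%:E))%E.
Proof.
move=> mf f0.
have dom : normal_prob m s `<< mu := normal_prob_dominates m s.
rewrite -(Radon_Nikodym_SigmaFinite.change_of_variables dom)//.
have iRN := Radon_Nikodym_SigmaFinite.f_integrable dom.
apply: ae_eq_integral => //.
- by apply: emeasurable_funM => //; exact: measurable_int iRN.
- apply: emeasurable_funM => //; apply/measurable_EFinP.
  exact: measurable_normal_pdf.
- apply: ae_eqe_mul2l; apply: integral_ae_eq => //.
  + by apply/measurable_EFinP; exact: measurable_normal_pdf.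
  + by move=> E _ mE; rewrite -Radon_Nikodym_SigmaFinite.f_integral.
Qed.

(* Completing the square turns the integrand into a multiple of another
   Gaussian density. *)
Lemma integral_normal_expN_sqr (t m s : R) : 0 < 1 + 2 * t * s ^+ 2 ->
  (\int[normal_prob 0 1]_x (expR (- t * (m + s * x) ^+ 2))%:E =
   ((Num.sqrt (1 + 2 * t * s ^+ 2))^-1 *
     expR (- t * m ^+ 2 / (1 + 2 * t * s ^+ 2)))%:E)%E.
Proof.
set D := 1 + _ => D0.
have sD0 : 0 < Num.sqrt D by rewrite sqrtr_gt0.
have mf : measurable_fun setT
    (fun x : measurableTypeR R => (expR (- t * (m + s * x) ^+ 2))%:E).
  apply/measurable_EFinP; apply: measurableT_comp => //.
  apply: measurable_funM => //; apply: measurable_funX.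
  by apply: measurable_funD => //; apply: measurable_funM.
rewrite ge0_integral_normal_prob//.
pose K := (Num.sqrt D)^-1 * expR (- t * m ^+ 2 / D).
(* These come from [t (m + s x)^2 + x^2 / 2 = t m^2 / D + D (x - m')^2 / 2]: the new density has
   mean [m'] and variance [1 / D]. *)
pose m' := - 2 * t * m * s / D; pose s' := (Num.sqrt D)^-1.
have s'0 : s' != 0 by rewrite gt_eqF// invr_gt0.
transitivity (\int[mu]_x (K%:E * (normal_pdf m' s' x)%:E))%E.
  apply: eq_integral => x _; rewrite -!EFinM; congr EFin.
  rewrite !normal_pdfE// ?oner_neq0//.
  rewrite /normal_peak /normal_fun /K.
  have -> : s' ^+ 2 = D^-1 by rewrite exprVn sqr_sqrtr// ltW.
  have -> : Num.sqrt (D^-1 * pi *+ 2) = (Num.sqrt D)^-1 * Num.sqrt (1 ^+ 2 * pi *+ 2).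
    by rewrite expr1n mul1r -mulrnAr sqrtrM ?invr_ge0 ?ltW// sqrtrV// ltW.
  rewrite invfM invrK; set S := (Num.sqrt _)^-1; set a := Num.sqrt D.
  have an0 : a != 0 by rewrite gt_eqF.
  have Dn0 : D != 0 by rewrite gt_eqF.
  transitivity (S * (expR (- t * m ^+ 2 / D) * expR (- (x - m') ^+ 2 / (D^-1 *+ 2)))).
    rewrite mulrCA -!expRD; congr (_ * expR _).
    by move: Dn0; rewrite /m' /D => Dn0; field.
  by field.
rewrite ge0_integralZl//.
- by rewrite integral_normal_pdf mule1.
- by apply/measurable_EFinP; exact: measurable_normal_pdf.
- by move=> x _; rewrite lee_fin normal_pdf_ge0.
- by rewrite lee_fin mulr_ge0// ?invr_ge0 ?expR_ge0// ltW.
Qed.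
End GaussianIntegral.

(** * Independence of one variable from all the others *)

Section Independence.
Context {R : realType} {dT : measure_display} {T : measurableType dT} (P : probability T R).

(** The joint law of [(Y, Z)] and the product of the two laws agree on rectangles, hence everywhere;
    Tonelli then integrates [Z] first, with [Y] frozen. *)
Lemma ge0_integral_indep (d1 d2 : measure_display) (T1 : measurableType d1)
    (T2 : measurableType d2) (Y : {mfun T >-> T1}) (Z : {mfun T >-> T2})
    (f : T1 * T2 -> \bar R) :
  (forall A B, measurable A -> measurable B ->
     P (Y @^-1` A `&` Z @^-1` B) = (P (Y @^-1` A) * P (Z @^-1` B))%E) ->
  measurable_fun setT f -> (forall x, (0 <= f x)%E) ->
  (\int[P]_w f (Y w, Z w) =
   \int[P]_w \int[distribution P Z]_z f (Y w, z))%E.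
Proof.
move=> indep mf f0.
have mYZ : measurable_fun setT (fun w => (Y w, Z w)).
  exact: measurable_fun_pair.
pose YZ : {mfun T >-> (T1 * T2)%type} :=
  HB.pack (fun w => (Y w, Z w)) (isMeasurableFun.Build _ _ _ _ _ mYZ).
have law X : measurable X ->
    (distribution P Y \x distribution P Z)%E X = distribution P YZ X.
  apply: product_measure_unique => A B mA mB.
  by rewrite /distribution /pushforward -indep.
transitivity (\int[distribution P YZ]_z f z)%E.
  by rewrite ge0_integral_pushforward.
rewrite (eq_measure_integral (distribution P Y \x distribution P Z)%E); last first.
  by move=> A mA _; exact/esym/law.
rewrite fubini_tonelli1// ge0_integral_pushforward//.
  exact: measurable_fun_fubini_tonelli_F.
by move=> x _; apply: integral_ge0.
Qed.

Context {J : finType} (X : J -> T -> R).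
Hypothesis mX : forall i, measurable_fun setT (X i).
Hypothesis indepX : forall B : J -> set R, (forall i, measurable (B i)) ->
  P (\bigcap_(i in [set: J]) (X i @^-1` B i)) = (\prod_i P (X i @^-1` B i))%E.

(** Leaving slot [k] in place with [B k = setT] lets [indepX] apply without reindexing, and the
    family stays closed under intersection. *)
Definition cylinders_off (k : J) : set (set T) :=
  [set A | exists B : J -> set R,
     [/\ forall i, measurable (B i), B k = setT &
         A = \bigcap_(i in [set: J]) (X i @^-1` B i)]].

(* T with the sigma-algebra generated by the X j, j != k: the identity map into
   it stands for the family of all the other variables, so that no product of
   |J| - 1 copies of R is needed. *)
Definition sigma_off (k : J) := g_sigma_algebraType (cylinders_off k).

Lemma measurable_preimage i (B : set R) : measurable B -> measurable (X i @^-1` B).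
Proof. by move=> mB; rewrite -[_ @^-1` _]setTI; exact: mX. Qed.

Lemma cylinders_off_measurable k : cylinders_off k `<=` measurable.
Proof.
move=> _ [B [mB _ ->]]; apply: fin_bigcap_measurable => // i _.
exact: measurable_preimage.
Qed.

(** As functions of [A], both sides are finite measures: a restriction of [P] and a multiple of [P].
    They agree on the intersection-stable family of cylinders, hence on the sigma-algebra it
    generates. *)
Lemma indep_sigma_off k (A : set T) (C : set R) :
  <<s cylinders_off k >> A -> measurable C ->
  P (A `&` X k @^-1` C) = (P A * P (X k @^-1` C))%E.
Proof.
move=> sA mC.
have mXC := measurable_preimage k mC.
have p0 : 0 <= fine (P (X k @^-1` C)) by rewrite fine_ge0.
have scaleE (E : set T) :
    mscale (NngNum p0) P E = (P E * P (X k @^-1` C))%E.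
  by rewrite /mscale/= fineK ?fin_num_measure// muleC.
rewrite -[LHS]/(mrestr P mXC A) -scaleE.
apply: (g_sigma_algebra_measure_unique _ (@cylinders_off_measurable k)
  (fun=> setT)) => //.
- move=> _; exists (fun=> setT); split => //.
  by rewrite bigcapT// preimage_setT.
- by rewrite bigcup_const.
- move=> _ _ [B [mB Bk ->]] [B' [mB' B'k ->]].
  exists (fun i => B i `&` B' i); split => [i| |].
  + exact: measurableI.
  + by rewrite Bk B'k setTI.
  + by rewrite -bigcapI.
- move=> _ [B [mB Bk ->]]; apply: etrans (esym (scaleE _)); rewrite /= /mrestr.
  (* Filling the free slot [k] with [C] makes the intersection a single event to which [indepX]
     applies. *)
  pose B' i := if i == k then C else B i.
  have mB' i : measurable (B' i) by rewrite /B'; case: ifP.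
  have -> : \bigcap_(i in [set: J]) (X i @^-1` B i) `&` X k @^-1` C =
      \bigcap_(i in [set: J]) (X i @^-1` B' i).
    apply/seteqP; split => w.
      by move=> [Bw Cw] i _; rewrite /= /B'; case: eqVneq => [->//|_]; exact: Bw.
    move=> B'w; split => [i _|].
      have := B'w i I; rewrite /= /B'; case: eqVneq => [->|//].
      by rewrite Bk.
    by have := B'w k I; rewrite /= /B' eqxx.
  rewrite !indepX// (bigD1 k)//= [in RHS](bigD1 k)//= /B' eqxx Bk.
  rewrite preimage_setT probability_setT mul1e [RHS]muleC; congr (_ * _)%E.
  by apply: eq_bigr => i /negPf ->.
- move=> _; apply: le_lt_trans (ltry 1); apply: probability_le1.
  by apply: measurableI.
Qed.

Lemma measurable_off j k : j != k ->
  measurable_fun [set: sigma_off k] (X j : sigma_off k -> R).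
Proof.
move=> jk _ A mA; rewrite setTI; apply: sub_sigma_algebra.
exists (fun i => if i == j then A else setT); split => [i| |].
- by case: ifP.
- by rewrite eq_sym (negPf jk).
- apply/seteqP; split => [w Aw i _ /=|w /(_ j I)/=]; last by rewrite eqxx.
  by case: eqVneq => [->|].
Qed.

Lemma measurable_off_measurable k (f : T -> R) :
  measurable_fun [set: sigma_off k] (f : sigma_off k -> R) ->
  measurable_fun [set: T] f.
Proof.
move=> mf _ A mA; rewrite setTI.
have : <<s cylinders_off k >> (f @^-1` A).
  by have := mf measurableT A mA; rewrite setTI.
apply: smallest_sub; last exact: cylinders_off_measurable.
exact: sigma_algebra_measurable.
Qed.

Hypothesis lawX : forall i (B : set R), measurable B ->
  P (X i @^-1` B) = normal_prob 0 1 B.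

(** Measurability for [sigma_off k] makes [h] and [m] functions of the other variables, so they stay
    frozen while [X k] is integrated against its own law. *)
Lemma ge0_integral_normal_off k (h m : T -> R) (f : R * R * R -> R) :
  measurable_fun [set: sigma_off k] (h : sigma_off k -> R) ->
  measurable_fun [set: sigma_off k] (m : sigma_off k -> R) ->
  measurable_fun setT f -> (forall x, 0 <= f x) ->
  (\int[P]_w (f (h w, m w, X k w))%:E =
   \int[P]_w \int[normal_prob 0 1]_x (f (h w, m w, x))%:E)%E.
Proof.
move=> mh mm mf f0.
have mid : measurable_fun [set: T] (id : T -> sigma_off k).
  move=> _ A; rewrite setTI preimage_id.
  apply: smallest_sub; last exact: cylinders_off_measurable.
  exact: sigma_algebra_measurable.
pose Y : {mfun T >-> sigma_off k} :=
  HB.pack (id : T -> sigma_off k) (isMeasurableFun.Build _ _ _ _ _ mid).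
have mXk : measurable_fun [set: T] (X k : T -> measurableTypeR R) by exact: mX.
pose Z : {mfun T >-> measurableTypeR R} :=
  HB.pack (X k : T -> measurableTypeR R) (isMeasurableFun.Build _ _ _ _ _ mXk).
rewrite (@ge0_integral_indep _ _ _ _ Y Z
  (fun z : sigma_off k * measurableTypeR R => (f (h z.1, m z.1, z.2))%:E)).
- apply: eq_integral => w _ /=.
  apply: eq_measure_integral => B mB _.
  exact: lawX.
- by move=> A B mA mB; exact: indep_sigma_off.
- apply/measurable_EFinP; apply: measurableT_comp => //.
  apply: measurable_fun_pair => //; apply: measurable_fun_pair.
    exact: measurableT_comp mh measurable_fst.
  exact: measurableT_comp mm measurable_fst.
- by move=> x; rewrite lee_fin.
Qed.
End Independence.

(** * Successive elimination of the Gaussian variables *)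

Section GaussianElim.
Context {R : realType} {dT : measure_display} {T : measurableType dT}
  (P : probability T R) {J : finType} (X : J -> T -> R).
Hypothesis mX : forall i, measurable_fun setT (X i).
Hypothesis lawX : forall i (B : set R), measurable B ->
  P (X i @^-1` B) = normal_prob 0 1 B.
Hypothesis indepX : forall B : J -> set R, (forall i, measurable (B i)) ->
  P (\bigcap_(i in [set: J]) (X i @^-1` B i)) = (\prod_i P (X i @^-1` B i))%E.

(** Integrating out [X k] keeps the shape of the integrand and only rescales [t], so the step can be
    repeated on a variable occurring in [m]. *)
Lemma integral_expN_sqr_off k (h m : T -> R) (t s : R) :
  measurable_fun [set: sigma_off X k] (h : sigma_off X k -> R) ->
  measurable_fun [set: sigma_off X k] (m : sigma_off X k -> R) ->
  (forall w, 0 <= h w) -> 0 < 1 + 2 * t * s ^+ 2 ->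
  (\int[P]_w (h w * expR (- t * (m w + s * X k w) ^+ 2))%:E =
   ((Num.sqrt (1 + 2 * t * s ^+ 2))^-1)%:E *
   \int[P]_w (h w * expR (- (t / (1 + 2 * t * s ^+ 2)) * m w ^+ 2))%:E)%E.
Proof.
move=> mh mm h0 D0; set D := 1 + _ in D0 *.
(* The absolute value makes [f] nonnegative at every argument, as the elimination of [X k] requires;
   it disappears at [h w]. *)
pose f (x : R * R * R) : R := `|x.1.1| * expR (- t * (x.1.2 + s * x.2) ^+ 2).
have mf : measurable_fun setT f.
  apply: measurable_funM; first by apply: measurableT_comp => //; exact: measurableT_comp.
  apply: measurableT_comp => //; apply: measurable_funM => //.
  apply: measurable_funX; apply: measurable_funD; first exact: measurableT_comp.
  exact: measurable_funM.
transitivity (\int[P]_w (f (h w, m w, X k w))%:E)%E.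
  by apply: eq_integral => w _; rewrite /f/= ger0_norm.
rewrite (ge0_integral_normal_off mX indepX lawX mh mm mf); last first.
  by move=> x; rewrite mulr_ge0// expR_ge0.
have mh' := measurable_off_measurable mX mh.
have mm' := measurable_off_measurable mX mm.
rewrite -ge0_integralZl//; last 2 first.
- apply/measurable_EFinP; apply: measurable_funM => //.
  apply: measurableT_comp => //; apply: measurable_funM => //.
  exact: measurable_funX.
- by move=> w _; rewrite lee_fin mulr_ge0// expR_ge0.
apply: eq_integral => w _; rewrite /f/= ger0_norm//.
under eq_integral do rewrite EFinM.
have mg : measurable_fun setT
    (fun x : measurableTypeR R => (expR (- t * (m w + s * x) ^+ 2))%:E).
  apply/measurable_EFinP; apply: measurableT_comp => //.
  apply: measurable_funM => //; apply: measurable_funX.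
  by apply: measurable_funD => //; exact: measurable_funM.
rewrite ge0_integralZl//; last by rewrite lee_fin.
rewrite integral_normal_expN_sqr// -!EFinM mulrCA; congr (_ * (_ * expR _))%:E.
by rewrite -/D !mulNr mulrAC.
Qed.

(** Induction on [r]: for each [l], first [X (c l)] and then [X (a l)] is eliminated, with factors
    [D1] and [D / D1] under the roots, whose product is [D]. Negative [t] is allowed, which gives
    the positive exponential moments of the Chernoff bound. *)
Lemma integral_expN_sqr_pair (L : eqType) (a c : L -> J) (p q t : R) (v : L -> R)
    (r : seq L) :
  injective a -> injective c -> (forall l l', a l != c l') ->
  0 < 1 + 2 * t * (p ^+ 2 + q ^+ 2) -> uniq r ->
  (\int[P]_w (\prod_(l <- r)
     expR (- t * (v l + p * X (a l) w + q * X (c l) w) ^+ 2))%:E =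
   (\prod_(l <- r) ((Num.sqrt (1 + 2 * t * (p ^+ 2 + q ^+ 2)))^-1 *
     expR (- t * v l ^+ 2 / (1 + 2 * t * (p ^+ 2 + q ^+ 2)))))%:E)%E.
Proof.
move=> ia ic ac; set D := 1 + _ => D0; elim: r => [_|l r IHr /=/andP[lr ur]].
  under eq_integral do rewrite big_nil.
  by rewrite integral_cst// big_nil mul1e; exact: probability_setT.
pose h w := \prod_(l <- r) expR (- t * (v l + p * X (a l) w + q * X (c l) w) ^+ 2).
have h0 w : 0 <= h w by apply: prodr_ge0 => i _; rewrite expR_ge0.
have mhk k : (forall l', l' \in r -> a l' != k /\ c l' != k) ->
    measurable_fun [set: sigma_off X k] (h : sigma_off X k -> R).
  move=> nk; apply: measurable_prod => l' /nk[ak ck].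
  apply: measurableT_comp => //; apply: measurable_funM => //.
  apply: measurable_funX; apply: measurable_funD.
    apply: measurable_funD => //; apply: measurable_funM => //.
    exact: measurable_off.
  by apply: measurable_funM => //; exact: measurable_off.
have q0 := sqr_ge0 q; have p0 := sqr_ge0 p.
pose D1 := 1 + 2 * t * q ^+ 2.
(* For [t < 0], [D <= D1] because [q^2 <= p^2 + q^2]. *)
have D1_gt0 : 0 < D1.
  have [t0|t0] := leP 0 t.
    by rewrite ltr_pwDl// mulr_ge0// mulr_ge0.
  by apply: lt_le_trans D0 _; rewrite lerD2l ler_nM2l ?lerDr// pmulr_rlt0.
have D2E : 1 + 2 * (t / D1) * p ^+ 2 = D / D1.
  by rewrite /D; move: (gt_eqF D1_gt0); rewrite /D1 => /negbT D1n0; field.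
have D2_gt0 : 0 < 1 + 2 * (t / D1) * p ^+ 2 by rewrite D2E divr_gt0.
transitivity (\int[P]_w
    (h w * expR (- t * ((v l + p * X (a l) w) + q * X (c l) w) ^+ 2))%:E)%E.
  by apply: eq_integral => w _; rewrite big_cons mulrC.
rewrite (@integral_expN_sqr_off (c l) h (fun w => v l + p * X (a l) w))//; last 2 first.
- apply: mhk => l' l'r; split=> //; apply/eqP => /ic l'l.
  by move: lr; rewrite -l'l l'r.
- by apply: measurable_funD => //; apply: measurable_funM => //; exact: measurable_off.
have mha : measurable_fun [set: sigma_off X (a l)] (h : sigma_off X (a l) -> R).
  apply: mhk => l' l'r; split; last by rewrite eq_sym.
  by apply/eqP => /ia l'l; move: lr; rewrite -l'l l'r.
rewrite -/D1 (@integral_expN_sqr_off (a l) h (cst (v l)))//= D2E.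
under eq_integral do rewrite EFinM.
rewrite ge0_integralZr//; last 2 first.
- by apply/measurable_EFinP; exact: (measurable_off_measurable mX mha).
- by move=> w _; rewrite lee_fin.
rewrite IHr// big_cons -!EFinM; congr EFin.
rewrite sqrtrM ?ltW// sqrtrV ?ltW//.
have a0 : Num.sqrt D1 != 0 by rewrite gt_eqF// sqrtr_gt0.
have b0 : Num.sqrt D != 0 by rewrite gt_eqF// sqrtr_gt0.
have -> : - (t / D1 / (D / D1)) * v l ^+ 2 = - t * v l ^+ 2 / D.
  by field; rewrite !gt_eqF.
by field; rewrite a0 b0.
Qed.
End GaussianElim.

(** * Elementary inequalities and the choice of the Chernoff parameter *)

Section Numerics.
Context {R : realType}.

(** With [x = m - m^2], [exp x <= 1 / (1 - x)], and [(1 + m) (1 - x) = 1 + m^3 >= 1]. *)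
Lemma expR_sub_sqr_le (m : R) : 0 <= m -> expR (m - m ^+ 2) <= 1 + m.
Proof.
move=> m0; have e := expR_ge1Dx (- (m - m ^+ 2)).
have h : expR (m - m ^+ 2) * (1 + - (m - m ^+ 2)) <= 1.
  by rewrite -[leRHS](expRxMexpNx_1 (m - m ^+ 2)) ler_pM2l// expR_gt0.
have q : 0 < 1 + - (m - m ^+ 2) by nra.
rewrite -(ler_pM2r q); apply: le_trans h _.
have -> : (1 + m) * (1 + - (m - m ^+ 2)) = 1 + m ^+ 3 by ring.
by rewrite lerDl exprn_ge0.
Qed.

(** With [x = m + 2 m^2], [exp (- x) <= 1 / (1 + x)], and
    [(1 - m) (1 + x) = 1 + m^2 (1 - 2 m) >= 1]. *)
Lemma expRN_sub_sqr_le (m : R) : 0 <= m <= 1 / 2 ->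
  expR (- m - 2 * m ^+ 2) <= 1 - m.
Proof.
move=> /andP[m0 m1].
have h : expR (- m - 2 * m ^+ 2) * (1 + (m + 2 * m ^+ 2)) <= 1.
  have -> : - m - 2 * m ^+ 2 = - (m + 2 * m ^+ 2) by ring.
  rewrite -[leRHS](expRxMexpNx_1 (m + 2 * m ^+ 2)) mulrC ler_pM2r ?expR_gt0//.
  exact: expR_ge1Dx.
have q : 0 < 1 + (m + 2 * m ^+ 2) by nra.
rewrite -(ler_pM2r q); apply: le_trans h _.
have -> : (1 - m) * (1 + (m + 2 * m ^+ 2)) = 1 + m ^+ 2 * (1 - 2 * m) by ring.
by rewrite lerDl mulr_ge0 ?sqr_ge0//; lra.
Qed.

Lemma sqrtV_le_expR (D y : R) :
  expR (- (2 * y)) <= D -> (Num.sqrt D)^-1 <= expR y.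
Proof.
move=> h; have D0 : 0 < D by apply: lt_le_trans h; exact: expR_gt0.
rewrite -[expR y]invrK -expRN lef_pV2 ?posrE ?sqrtr_gt0 ?expR_gt0//.
rewrite -[expR _]ger0_norm ?expR_ge0// -sqrtr_sqr ler_sqrt ?(ltW D0)//.
by rewrite -expRM_natl mulrN.
Qed.

Lemma bound3_gt0 (n d : nat) (alpha : R) :
  (0 < n)%N -> 0 < alpha < 1 -> 0 < bound3 n d alpha.
Proof.
move=> n0 /andP[a0 a1]; rewrite /bound3 mulr_gt0// lt_max sqrtr_gt0.
have n1 : 1 <= n%:R ^+ 2 :> R by rewrite exprn_ege1// ler1n.
by rewrite mulr_gt0 ?ln_gt0// ltr_pdivlMr// mul1r; lra.
Qed.

(** Each term of the maximum is squared and multiplied by 16; in the first, [ln (8 n^2 / alpha)] is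
    weakened to [L]. *)
Lemma bound3_sqr_ge (n d : nat) (alpha : R) (L : R) :
  (0 < n)%N -> 0 < alpha < 1 -> L = ln (4 * n%:R ^+ 2 / alpha) ->
  [/\ 0 < L, 32 * L <= bound3 n d alpha ^+ 2 &
      16 * Num.sqrt (d%:R * L) <= bound3 n d alpha ^+ 2].
Proof.
move=> n0 /andP[a0 a1] LE.
have n1 : 1 <= n%:R ^+ 2 :> R by rewrite exprn_ege1// ler1n.
have L0 : 0 < L by rewrite LE ln_gt0// ltr_pdivlMr// mul1r; lra.
pose L8 : R := ln (8 * n%:R ^+ 2 / alpha).
have LL8 : L <= L8.
  rewrite LE ler_ln ?posrE ?divr_gt0//; [|lra|lra].
  by rewrite ler_pM2r ?invr_gt0//; lra.
rewrite /bound3 -LE -/L8 exprMn; set M := Num.max _ _.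
have e16 : 4 ^+ 2 = 16 :> R by ring.
split=> //.
- have : 2 * L8 <= M ^+ 2.
    rewrite -[leLHS]sqr_sqrtr; last by rewrite mulr_ge0//; lra.
    by rewrite ler_sqr ?nnegrE ?le_max ?lexx ?sqrtr_ge0.
  by rewrite e16; lra.
- rewrite e16 ler_pM2l//.
  have dL : 0 <= d%:R * L by rewrite mulr_ge0// ltW.
  have -> : Num.sqrt (d%:R * L) = ((d%:R * L) `^ 4^-1) ^+ 2.
    rewrite -powR12_sqrt// -powR_mulrn ?powR_ge0// -powRrM; congr (_ `^ _).
    by field.
  by rewrite ler_sqr ?nnegrE ?le_max ?lexx ?powR_ge0 ?orbT.
Qed.

(** If [d <= 4 L], take [m = 1/2]: the exponent is at most [L - 32 L / 12]. Otherwise take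
    [m = sqrt (L / d)], so that [m^2 d = L] and [m K / 6 >= 16 L / 6]. Both cases give at most
    [- 5 L / 3]. *)
Lemma chernoff_exponent (d L K : R) : 0 < L -> 0 <= d ->
  32 * L <= K -> 16 * Num.sqrt (d * L) <= K ->
  exists2 m : R, 0 <= m <= 1 / 2 & m ^+ 2 * d - m * K / 6 <= - L.
Proof.
move=> L0 d0 K1 K2; have [dL|Ld] := leP d (4 * L).
  by exists (1 / 2); lra.
have d_gt0 : 0 < d by lra.
exists (Num.sqrt (L / d)).
  rewrite sqrtr_ge0/= -[leRHS]ger0_norm ?divr_ge0// -sqrtr_sqr ler_sqrt.
    by rewrite ler_pdivrMr//; lra.
  by lra.
have E : Num.sqrt (L / d) * Num.sqrt (d * L) = L.
  rewrite -sqrtrM ?divr_ge0 ?ltW//.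
  have -> : L / d * (d * L) = L ^+ 2 by field; rewrite gt_eqF.
  by rewrite sqrtr_sqr ger0_norm// ltW.
have := ler_wpM2l (sqrtr_ge0 (L / d)) K2.
rewrite mulrCA E sqr_sqrtr ?divr_ge0 ?(ltW L0)// divfK ?gt_eqF//.
by lra.
Qed.

End Numerics.

(** * From an estimation error to one wrong pair *)

Section Matching.
Context {R : realType}.

Lemma perm_neq_ex (n : nat) (pi pis : 'S_n) :
  pi != pis -> exists i, pi i != pis i.
Proof.
move=> /eqP neq; apply: contrapT => /forallNP h; apply: neq.
by apply/permP => i; apply/eqP/negPn/negP; exact: h.
Qed.

Lemma ltr_sum_ex (I : finType) (F G : I -> R) (i0 : I) :
  (forall i, F i <= G i) -> F i0 < G i0 -> \sum_i F i < \sum_i G i.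
Proof.
move=> FG FG0; rewrite (bigD1 i0)//= [ltRHS](bigD1 i0)//=.
by rewrite ltr_leD// ler_sum.
Qed.

(** Otherwise every term where the permutations differ would be strictly larger for [pi], the other
    terms being equal, and [pi] would cost strictly more than [pis]. *)
Lemma lsns_wrong_pair (n d : nat) (sigma : 'I_n -> R)
    (X Xs : 'I_n -> 'rV[R]_d) (pi pis : 'S_n) : pi != pis ->
  lsns_cost sigma (fun i => sigma (pis i)) X Xs pi <=
    lsns_cost sigma (fun i => sigma (pis i)) X Xs pis ->
  exists2 i, pi i != pis i &
    sqnorm (X (pi i) - Xs i) / (sigma (pi i) ^+ 2 + sigma (pis i) ^+ 2) <=
    sqnorm (X (pis i) - Xs i) / (sigma (pis i) ^+ 2 + sigma (pis i) ^+ 2).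
Proof.
move=> /perm_neq_ex[i0 i0P]; apply: contraPP => /forall2NP h.
have lt i : pi i != pis i ->
    sqnorm (X (pis i) - Xs i) / (sigma (pis i) ^+ 2 + sigma (pis i) ^+ 2) <
    sqnorm (X (pi i) - Xs i) / (sigma (pi i) ^+ 2 + sigma (pis i) ^+ 2).
  by move=> ii; have [//|/negP] := h i; rewrite -ltNge.
apply/negP; rewrite -ltNge; apply: (ltr_sum_ex (i0 := i0)); last exact: lt.
by move=> i; have [->|/lt/ltW] := eqVneq (pi i) (pis i).
Qed.

Lemma sqnorm_ge0 (d : nat) (v : 'rV[R]_d) : 0 <= sqnorm v.
Proof. by apply: sumr_ge0 => k _; exact: sqr_ge0. Qed.

(* By AM-GM, sigma_(pi i)^2 + sigma_(pis i)^2 >= 2 sigma_(pi i) sigma_(pis i),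
   and the product over i of the right-hand sides does not depend on pi. *)
Lemma lsl_wrong_pair (n d : nat) (sigma : 'I_n -> R)
    (X Xs : 'I_n -> 'rV[R]_d) (pi pis : 'S_n) : (forall i, 0 < sigma i) ->
  pi != pis -> (lsl_cost X Xs pi <= lsl_cost X Xs pis)%E ->
  (exists2 i, pi i != pis i &
    sqnorm (X (pi i) - Xs i) / (sigma (pi i) ^+ 2 + sigma (pis i) ^+ 2) <=
    sqnorm (X (pis i) - Xs i) / (sigma (pis i) ^+ 2 + sigma (pis i) ^+ 2)) \/
  exists i, sqnorm (X (pis i) - Xs i) = 0.
Proof.
move=> s0 /perm_neq_ex[i0 i0P]; apply: contraPP => /not_orP[/forall2NP h /forallNP n0].
pose a i := sqnorm (X (pi i) - Xs i); pose b i := sqnorm (X (pis i) - Xs i).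
have b0 i : 0 < b i by rewrite lt_def sqnorm_ge0 andbT; apply/eqP; exact: n0.
have lt i : pi i != pis i ->
    b i / (sigma (pis i) ^+ 2 + sigma (pis i) ^+ 2) <
    a i / (sigma (pi i) ^+ 2 + sigma (pis i) ^+ 2).
  by move=> ii; have [//|/negP] := h i; rewrite -ltNge.
have ss0 i j : 0 < sigma i ^+ 2 + sigma j ^+ 2 by rewrite addr_gt0// exprn_gt0.
have prod_lt i : pi i != pis i -> b i * sigma (pi i) < a i * sigma (pis i).
  move=> /lt; rewrite ltr_pdivrMr// mulrAC ltr_pdivlMr// => ba.
  have sp := s0 (pis i); have sq := s0 (pi i); have bi := b0 i.
  have sp2 : 0 < 2 * sigma (pis i) by rewrite mulr_gt0.
  rewrite -(ltr_pM2r sp2).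
  have : 0 <= b i * (sigma (pi i) - sigma (pis i)) ^+ 2.
    by rewrite mulr_ge0 ?sqr_ge0// ltW.
  by nra.
(* Positivity of [a] and [b] keeps [elog] away from [-oo], so both costs are real sums of
   logarithms. *)
have a0 i : 0 < a i.
  have [ii|/prod_lt] := eqVneq (pi i) (pis i); first by rewrite /a ii; exact: b0.
  by move=> /(lt_trans (mulr_gt0 (b0 i) (s0 _))); rewrite pmulr_lgt0.
have ln_lt i : pi i != pis i ->
    ln (b i) + ln (sigma (pi i)) < ln (a i) + ln (sigma (pis i)).
  by move=> /prod_lt; rewrite -!lnM ?posrE// ltr_ln ?posrE ?mulr_gt0.
have : \sum_i (ln (b i) + ln (sigma (pi i))) <
       \sum_i (ln (a i) + ln (sigma (pis i))).
  apply: (ltr_sum_ex (i0 := i0)); last exact: ln_lt.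
  move=> i; have [ii|/ln_lt/ltW//] := eqVneq (pi i) (pis i).
  by rewrite /a /b ii.
have sum_sigma (c : 'S_n) : \sum_i ln (sigma (c i)) = \sum_i ln (sigma i).
  by rewrite [RHS](reindex_perm c).
rewrite !big_split/= !sum_sigma ltrD2r => ltab.
have costE (c : 'S_n) (e : 'I_n -> R) :
    (forall i, e i = sqnorm (X (c i) - Xs i)) -> (forall i, 0 < e i) ->
    lsl_cost X Xs c = (\sum_i ln (e i))%:E.
  move=> eE e0; rewrite /lsl_cost -sumEFin; apply: eq_bigr => i _.
  by rewrite -eE /elog gt_eqF.
apply/negP; rewrite -ltNge (costE pi a)// (costE pis b)//.
Qed.

End Matching.

(** * Probability of a wrong pair and the union bound *)

Section ErrorProbability.
Context {R : realType} {dT : measure_display} {T : measurableType dT}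
  (P : probability T R) {n d : nat} (xi xis : 'I_n -> 'I_d -> T -> R).
Hypothesis iid : iid_std_gaussian P xi xis.
Variables (sigma : 'I_n -> R) (theta : 'I_n -> 'rV[R]_d) (pis : 'S_n).
Hypothesis sigma_gt0 : forall i, 0 < sigma i.

Let dist2 i j (w : T) : R :=
  sqnorm (obsX xi theta sigma w j - obsXs xis theta sigma pis w i) /
  (sigma j ^+ 2 + sigma (pis i) ^+ 2).

Let sep2 i j : R :=
  sqnorm (theta j - theta (pis i)) / (sigma j ^+ 2 + sigma (pis i) ^+ 2).

Let sigma2_gt0 i j : 0 < sigma i ^+ 2 + sigma j ^+ 2.
Proof. by rewrite addr_gt0// exprn_gt0. Qed.

(** The two noise coefficients have squares summing to 1, so when the two indices are fixed this is
    the squared norm of a shifted standard Gaussian vector. *)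
Let dist2E i j w : let s := Num.sqrt (sigma j ^+ 2 + sigma (pis i) ^+ 2) in
  dist2 i j w = \sum_(l < d)
    ((theta j - theta (pis i)) ord0 l / s + sigma j / s * xi j l w +
     (- sigma (pis i) / s) * xis i l w) ^+ 2.
Proof.
move=> s; have s0 : s != 0 by rewrite gt_eqF// sqrtr_gt0.
rewrite /dist2 /sqnorm mulr_suml; apply: eq_bigr => l _.
rewrite !mxE -[sigma j ^+ 2 + _]sqr_sqrtr ?(ltW (sigma2_gt0 _ _))// -/s.
by field.
Qed.

Let measurable_dist2 i j : measurable_fun setT (dist2 i j).
Proof.
have [mX _] := iid.
rewrite (funext (dist2E i j)).
apply: measurable_sum => l; apply: measurable_funX; apply: measurable_funD.
  apply: measurable_funD => //; apply: measurable_funM => //.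
  exact: (mX (inl (j, l))).
by apply: measurable_funM => //; exact: (mX (inr (i, l))).
Qed.

Let measurable_exp_dist2 t i j :
  measurable_fun setT (fun w => expR (t * dist2 i j w)).
Proof. by apply: measurableT_comp => //; exact: measurable_funM. Qed.

(** This is the Laplace transform of the noncentral chi-squared law with [d] degrees of freedom and
    noncentrality [sep2 i j]. *)
Lemma integral_expN_dist2 t i j : 0 < 1 + 2 * t ->
  (\int[P]_w (expR (- t * dist2 i j w))%:E =
   ((Num.sqrt (1 + 2 * t))^-1 ^+ d * expR (- t * sep2 i j / (1 + 2 * t)))%:E)%E.
Proof.
move=> t0; have [mX [lawX indepX]] := iid.
set s := Num.sqrt (sigma j ^+ 2 + sigma (pis i) ^+ 2).
have s2 : s ^+ 2 = sigma j ^+ 2 + sigma (pis i) ^+ 2.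
  by rewrite sqr_sqrtr// ltW.
have s0 : s != 0 by rewrite gt_eqF// sqrtr_gt0.
have pq : (sigma j / s) ^+ 2 + (- sigma (pis i) / s) ^+ 2 = 1.
  by rewrite !expr_div_n sqrrN -mulrDl -s2 divff// expf_neq0.
have t0' : 0 < 1 + 2 * t * ((sigma j / s) ^+ 2 + (- sigma (pis i) / s) ^+ 2).
  by rewrite pq mulr1.
have ia : injective (fun l : 'I_d => inl (j, l) : @noise_idx n d) by move=> ? ? [].
have ic : injective (fun l : 'I_d => inr (i, l) : @noise_idx n d) by move=> ? ? [].
transitivity (\int[P]_w (\prod_(l <- index_enum 'I_d)
    expR (- t * ((theta j - theta (pis i)) ord0 l / s +
      sigma j / s * noise_var xi xis (inl (j, l)) w +
      (- sigma (pis i) / s) * noise_var xi xis (inr (i, l)) w) ^+ 2))%:E)%E.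
  by apply: eq_integral => w _; rewrite dist2E mulr_sumr expR_sum.
rewrite (integral_expN_sqr_pair mX lawX indepX
  (fun l => (theta j - theta (pis i)) ord0 l / s) ia ic _ t0')//; last first.
  exact: index_enum_uniq.
rewrite pq mulr1 big_split/= prodr_const card_ord -expR_sum; congr (_ * expR _)%:E.
rewrite -mulr_suml -mulr_sumr; congr (_ * _ / _).
rewrite /sep2 /sqnorm mulr_suml; apply: eq_bigr => l _.
by rewrite expr_div_n s2.
Qed.

Let sep2_id i : sep2 i (pis i) = 0.
Proof.
rewrite /sep2 subrr /sqnorm big1 ?mul0r// => k _.
by rewrite mxE expr0n.
Qed.

(* Chernoff bound for [dist2 i j <= dist2 i (pis i)]: the two terms multiply to
   [expR (m / 2 * (dist2 i (pis i) - dist2 i j))], so that one of them is at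
   least 1 on this event; [c] balances their expectations. *)
Let pair_bound (m c : R) i j w : R :=
  c * expR (m / 2 * dist2 i (pis i) w) + c^-1 * expR (- (m / 2) * dist2 i j w).

Let pair_bound_ge0 m c i j w : 0 < c -> 0 <= pair_bound m c i j w.
Proof.
by move=> c0; rewrite addr_ge0// mulr_ge0 ?expR_ge0// ?invr_ge0 ltW.
Qed.

Let pair_bound_ge1 m c i j w : 0 <= m -> 0 < c ->
  dist2 i j w <= dist2 i (pis i) w -> 1 <= pair_bound m c i j w.
Proof.
move=> m0 c0 le12; rewrite /pair_bound.
set a := c * _; set b := c^-1 * _.
have a0 : 0 < a by rewrite mulr_gt0// expR_gt0.
have b0 : 0 < b by rewrite mulr_gt0 ?invr_gt0// expR_gt0.
have ab : 1 <= a * b.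
  rewrite /a /b mulrACA divff ?gt_eqF// mul1r -expRD -expR0 ler_expR.
  by rewrite mulNr subr_ge0 ler_wpM2l// divr_ge0.
have [a1|a1] := leP 1 a; first by rewrite (le_trans a1)// lerDl ltW.
have : 1 <= b by apply: le_trans ab _; rewrite ger_pMl// ltW.
by move=> b1; rewrite (le_trans b1)// lerDr ltW.
Qed.

(** The value of [c] cancels the terms in [m d / 2], which have opposite signs in the two
    expectations, and shares the gain [m K / 3] equally. The first term is then at most
    [exp (m^2 d - m K / 6)], the second at most [exp (m^2 d / 2 - m K / 6)]. *)
Let integral_pair_bound_le m K i j : 0 <= m <= 1 / 2 -> K <= sep2 i j ->
  (\int[P]_w (pair_bound m (expR (- (m / 2 * d%:R) - m * K / 6)) i j w)%:E <=
   (2 * expR (m ^+ 2 * d%:R - m * K / 6))%:E)%E.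
Proof.
move=> /andP[m0 m1] Kle; set c := expR _.
under eq_integral do rewrite EFinD.
have c0 : 0 < c by exact: expR_gt0.
have dn : 0 <= d%:R :> R by exact: ler0n.
have m2 : 0 <= m ^+ 2 by exact: sqr_ge0.
have md : 0 <= m ^+ 2 * d%:R by exact: mulr_ge0.
rewrite ge0_integralD//; last 4 first.
- by move=> w _; rewrite lee_fin mulr_ge0 ?expR_ge0// ltW.
- by apply/measurable_EFinP; apply: measurable_funM.
- by move=> w _; rewrite lee_fin mulr_ge0 ?expR_ge0// invr_ge0 ltW.
- by apply/measurable_EFinP; apply: measurable_funM.
rewrite mulrDl mul1r EFinD; apply: leeD.
  under eq_integral do rewrite EFinM.
  rewrite ge0_integralZl//; last 2 first.
  - exact/measurable_EFinP.
  - by rewrite lee_fin ltW.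
  (* The true pair has noncentrality 0, and its transform is taken at the negative argument
     [- m / 2], where [1 - m > 0]. *)
  rewrite -[m / 2]opprK integral_expN_dist2; last by lra.
  rewrite sep2_id mulr0 mul0r expR0 mulr1 -EFinM lee_fin.
  have -> : 1 + 2 * - (m / 2) = 1 - m by lra.
  have h : (Num.sqrt (1 - m))^-1 <= expR (m / 2 + m ^+ 2).
    apply: sqrtV_le_expR; have -> : - (2 * (m / 2 + m ^+ 2)) = - m - 2 * m ^+ 2 by lra.
    by apply: expRN_sub_sqr_le; rewrite m0.
  have /(ler_wpM2l (ltW c0))/le_trans : (Num.sqrt (1 - m))^-1 ^+ d <=
      expR (m / 2 + m ^+ 2) ^+ d.
    by rewrite lerXn2r// nnegrE ?invr_ge0 ?expR_ge0.
  apply; rewrite -expRM_natl -expRD ler_expR; lra.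
under eq_integral do rewrite EFinM.
rewrite ge0_integralZl//; last 2 first.
- exact/measurable_EFinP.
- by rewrite lee_fin invr_ge0 ltW.
rewrite integral_expN_dist2; last by lra.
rewrite -EFinM lee_fin -expRN.
have -> : 1 + 2 * (m / 2) = 1 + m by lra.
have h : (Num.sqrt (1 + m))^-1 <= expR (- (m / 2) + m ^+ 2 / 2).
  apply: sqrtV_le_expR; have -> : - (2 * (- (m / 2) + m ^+ 2 / 2)) = m - m ^+ 2 by lra.
  exact: expR_sub_sqr_le.
have hd : (Num.sqrt (1 + m))^-1 ^+ d <= expR (- (m / 2) + m ^+ 2 / 2) ^+ d.
  by rewrite lerXn2r// nnegrE ?invr_ge0 ?expR_ge0.
(* Since [m <= 1/2], [1 + m <= 3/2]; this is where the constant 3 arises. *)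
have hs : - (m / 2) * sep2 i j / (1 + m) <= - (m * K / 3).
  rewrite ler_pdivrMr; last by lra.
  have mS : 0 <= m * sep2 i j.
    by rewrite mulr_ge0// divr_ge0 ?sqnorm_ge0// ltW.
  have h1 : 0 <= m * sep2 i j * (1 / 2 - m) by rewrite mulr_ge0//; lra.
  have h2 : 0 <= m * (sep2 i j - K) * (1 + m).
    by rewrite mulr_ge0// ?addr_ge0// mulr_ge0// subr_ge0.
  lra.
apply: (@le_trans _ _ (expR (- (- (m / 2 * d%:R) - m * K / 6)) *
  (expR (- (m / 2) + m ^+ 2 / 2) ^+ d * expR (- (m * K / 3))))).
  rewrite ler_wpM2l ?expR_ge0// ler_pM ?expR_ge0 ?exprn_ge0 ?invr_ge0//.
  by rewrite ler_expR.
rewrite -expRM_natl -!expRD ler_expR; lra.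
Qed.

(** The noncentrality is 0, and a base at most 1 raised to a power [d >= 1] does not exceed the
    base. *)
Let integral_null_bound_le t i : (1 <= d)%N -> 0 < t ->
  (\int[P]_w (expR (- t * dist2 i (pis i) w))%:E <=
   ((Num.sqrt (1 + 2 * t))^-1)%:E)%E.
Proof.
move=> d1 t0; rewrite integral_expN_dist2; last by lra.
rewrite sep2_id mulr0 mul0r expR0 mulr1 lee_fin -[leRHS]expr1.
apply: ler_wiXn2l => //.
rewrite invf_le1 ?sqrtr_gt0; last by lra.
by rewrite -[leLHS]sqrtr1 ler_sqrt; lra.
Qed.

Let kbar_sep2 (kappa : R) i j : 0 < kappa -> (kappa%:E < kbar theta sigma)%E ->
  j != pis i -> kappa ^+ 2 <= sep2 i j.
Proof.
move=> k0 /bigmin_gtP[_ /(_ j isT)/bigmin_gtP[_ /(_ (pis i))]] /[apply].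
rewrite lte_fin => /ltW lek.
rewrite -[leRHS]sqr_sqrtr; last by rewrite divr_ge0 ?sqnorm_ge0// ltW.
rewrite ler_sqr ?nnegrE ?(ltW k0)// (le_trans lek)//.
by rewrite /sep2 sqrtrM ?sqnorm_ge0// sqrtrV// ltW.
Qed.

(** Union bound in integral form: the indicator of [E] is dominated by a sum of [n^2] nonnegative
    functions, each of integral at most [alpha / n^2]. *)
Lemma error_prob_le (alpha : R) (E : set T) :
  (2 <= n)%N -> (1 <= d)%N -> 0 < alpha < 1 -> measurable E ->
  ((bound3 n d alpha)%:E < kbar theta sigma)%E ->
  (forall w, E w ->
    (exists i j, j != pis i /\ dist2 i j w <= dist2 i (pis i) w) \/
    exists i, dist2 i (pis i) w = 0) ->
  (P E <= alpha%:E)%E.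
Proof.
move=> n2 d1 alpha01 mE kappa_lt EP.
have n0 : (0 < n)%N by exact: ltnW.
set kappa := bound3 n d alpha in kappa_lt.
have kappa0 : 0 < kappa by exact: bound3_gt0.
have [L0 K1 K2] := bound3_sqr_ge d n0 alpha01 erefl.
set L := ln _ in L0 K1 K2; rewrite -/kappa in K1 K2.
have [m m01 mL] := chernoff_exponent L0 (ler0n R d) K1 K2.
have /andP[m0 _] := m01.
set c := expR (- (m / 2 * d%:R) - m * kappa ^+ 2 / 6).
have c0 : 0 < c by exact: expR_gt0.
have /andP[a0 a1] := alpha01.
have nR : 1 < n%:R :> R by rewrite ltr1n.
pose N : R := n%:R ^+ 2.
have N1 : 1 < N by rewrite exprn_egt1.
(* Solves [(1 + 2 t)^(-1/2) = alpha / N]. *)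
pose t : R := ((N / alpha) ^+ 2 - 1) / 2.
have Na1 : 1 < N / alpha by rewrite ltr_pdivlMr// mul1r; lra.
have t0 : 0 < t by rewrite divr_gt0// subr_gt0 exprn_egt1.
have tE : (Num.sqrt (1 + 2 * t))^-1 = alpha / N.
  have -> : 1 + 2 * t = (N / alpha) ^+ 2 by rewrite /t; lra.
  by rewrite sqrtr_sqr ger0_norm ?invf_div// ltW// (lt_trans _ Na1).
(* The 4 inside [L] gives [2 exp (- L) = alpha / (2 N)]. *)
have expL : 2 * expR (- L) <= alpha / N.
  have aN : 0 < alpha / N by rewrite divr_gt0// (lt_trans _ N1).
  have aN4 : 0 < 4 * N / alpha by rewrite divr_gt0// mulr_gt0// (lt_trans _ N1).
  rewrite expRN lnK ?posrE// invf_div.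
  have -> : alpha / (4 * N) = alpha / N / 4 by rewrite invfM mulrCA mulrC.
  lra.
(* The pairs [(i, pis i)], which are never wrong matches, carry the coincidences, so both kinds of
   failure fit in [n^2] terms. *)
pose F (k : 'I_n * 'I_n) w := if k.2 == pis k.1
  then expR (- t * dist2 k.1 (pis k.1) w) else pair_bound m c k.1 k.2 w.
have F0 k w : 0 <= F k w.
  by rewrite /F; case: ifP => _; rewrite ?expR_ge0 ?pair_bound_ge0.
have mF k : measurable_fun setT (fun w => (F k w)%:E).
  apply/measurable_EFinP; rewrite /F; case: (k.2 == pis k.1) => //.
  by apply: measurable_funD; apply: measurable_funM.
have FP k : (\int[P]_w (F k w)%:E <= (alpha / N)%:E)%E.
  rewrite /F; case: (eqVneq k.2 (pis k.1)) => [_|kk].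
    by rewrite -tE; exact: integral_null_bound_le.
  apply: le_trans (integral_pair_bound_le m01 (kbar_sep2 kappa0 kappa_lt kk)) _.
  by rewrite lee_fin (le_trans _ expL)// ler_pM2l// ler_expR.
have F1 w : E w -> exists k, 1 <= F k w.
  move=> /EP[[i [j [ji le12]]]|[i d0]].
    by exists (i, j); rewrite /F/= (negPf ji) pair_bound_ge1.
  by exists (i, pis i); rewrite /F/= eqxx d0 mulr0 expR0.
rewrite -[E]setIT -integral_indic//.
apply: (@le_trans _ _ (\int[P]_w (\sum_k (F k w)%:E))%E).
  apply: ge0_le_integral => //.
  - by apply/measurable_EFinP; exact: measurable_indic.
  - exact: emeasurable_sum.
  - move=> w _; rewrite indicE; case: (boolP (w \in E)) => [/set_mem/F1[k k1]|_].
      rewrite (bigD1 k)//= -[leLHS]adde0 leeD// ?lee_fin//.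
      by apply: sume_ge0 => k' _; rewrite lee_fin.
    by apply: sume_ge0 => k' _; rewrite lee_fin.
rewrite ge0_integral_sum//; last by move=> k w _; rewrite lee_fin.
apply: (@le_trans _ _ (\sum_(k : 'I_n * 'I_n) (alpha / N)%:E)%E).
  by apply: lee_sum => k _; exact: FP.
rewrite sumEFin sumr_const card_prod card_ord lee_fin -mulr_natr natrM -expr2 -/N.
by rewrite divfK// gt_eqF// (lt_trans _ N1).
Qed.

End ErrorProbability.

(** * The bound on the perceivable separation distance for both estimators *)

Unset Implicit Arguments.

Theorem theorem3 (R : realType) (dT : measure_display) (T : measurableType dT)
    (P : probability T R) (n d : nat) (alpha : R) (sigma : 'I_n -> R)
    (xi xis : 'I_n -> 'I_d -> T -> R) :
  (2 <= n)%N -> (1 <= d)%N -> 0 < alpha < 1 ->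
  (forall i, 0 < sigma i) ->
  iid_std_gaussian P xi xis ->
  (forall est : estimator n d, is_LSNS est ->
     (forall theta pis, measurable (err_event xi xis est theta sigma pis)) ->
     (perceivable P xi xis est sigma alpha <= (bound3 n d alpha)%:E)%E) /\
  (forall est : estimator n d, is_LSL est ->
     (forall theta pis, measurable (err_event xi xis est theta sigma pis)) ->
     (perceivable P xi xis est sigma alpha <= (bound3 n d alpha)%:E)%E).
Proof.
move=> n2 d1 alpha01 sigma0 iid.
have perceivable_le (est : estimator n d) :
    (forall theta pis w,
      let X := obsX xi theta sigma w in
      let Xs := obsXs xis theta sigma pis w in
      let pi := est sigma (fun i => sigma (pis i)) X Xs in
      pi != pis ->
      (exists2 i, pi i != pis i &
        sqnorm (X (pi i) - Xs i) / (sigma (pi i) ^+ 2 + sigma (pis i) ^+ 2) <=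
        sqnorm (X (pis i) - Xs i) / (sigma (pis i) ^+ 2 + sigma (pis i) ^+ 2)) \/
      exists i, sqnorm (X (pis i) - Xs i) = 0) ->
    (forall theta pis, measurable (err_event xi xis est theta sigma pis)) ->
    (perceivable P xi xis est sigma alpha <= (bound3 n d alpha)%:E)%E.
  (* It suffices that [bound3 n d alpha] is itself an admissible [kappa] in the set whose infimum is
     taken. *)
  move=> errP mE; apply: ereal_inf_lbound; exists (bound3 n d alpha) => //.
  split=> [|pis theta kappa_lt]; first by rewrite bound3_gt0// ltnW.
  apply: (error_prob_le iid sigma0 n2 d1 alpha01 (mE theta pis) kappa_lt).
  move=> w /errP[[i neq le_i]|[i eq0]].
    by left; exists i; eexists; split; first exact: neq.
  by right; exists i; rewrite eq0 mul0r.
split=> est estP; apply: perceivable_le => theta pis w X Xs pi neq.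
  by left; apply: lsns_wrong_pair neq _; exact: estP.
by apply: lsl_wrong_pair neq _ => //; exact: estP.
Qed.
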